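(* Let $\Delta\subset\mathbb{R}^2$ be a triangle with vertices $A=(a_1,a_2)^T$, $B=(0,0)^T$, $C=(c_1,0)^T$, where $a_2,c_1>0$. Let $\delta\in(0,a_2)$ and $\Delta_\delta=\{x\in\Delta:\mathrm{dist}(x,BC)>\delta\}$, where $\mathrm{dist}(x,BC)=\min\{|x-y|:y\in BC\}$ and $BC$ is the side of $\Delta$ joining $B$ and $C$. Let $p\ge 1$ be an integer. Then $$\|v\|_{L^2(\Delta)}\le\mathsf{T}\left(\frac{1+\delta a_2^{-1}}{1-\delta a_2^{-1}}\right)^{2p+3/2}\|v\|_{L^2(\Delta_\delta)}\qquad\forall v\in Q_p(\Delta),$$ where $\mathsf{T}(t)=t+\sqrt{t^2-1}$ for $t\ge 1$.
   Context: $Q_p(\Delta)$ denotes the restrictions to $\Delta$ of all real polynomials in $(x_1,x_2)$ of degree at most $p$ in each variable separately. *)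

(* Defs.v *)
From HB Require Import structures.
From mathcomp Require Import all_boot all_order all_algebra.
From mathcomp Require Import all_classical all_reals all_analysis.

Set Implicit Arguments.
Unset Strict Implicit.
Unset Printing Implicit Defensive.

Import Order.TTheory GRing.Theory Num.Theory.
Import numFieldNormedType.Exports.

Local Open Scope classical_set_scope.
Local Open Scope ring_scope.

Section Plane.
Context {R : realType}.
Implicit Types (x y A B C : R * R) (D : set (R * R)) (v : R * R -> R).

Definition segment A B : set (R * R) :=
  [set x | exists s t : R, [/\ 0 <= s, 0 <= t, s + t = 1,
    x.1 = s * A.1 + t * B.1 & x.2 = s * A.2 + t * B.2]].

Definition triangle A B C : set (R * R) :=
  [set x | exists r s t : R, [/\ [/\ 0 <= r, 0 <= s & 0 <= t], r + s + t = 1,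
    x.1 = r * A.1 + s * B.1 + t * C.1 & x.2 = r * A.2 + s * B.2 + t * C.2]].

(* The library norm on R * R is the max norm, hence an explicit Euclidean
   distance. *)
Definition edist2 x y : R :=
  Num.sqrt ((x.1 - y.1) ^+ 2 + (x.2 - y.2) ^+ 2).

(* A minimum whenever D is nonempty and compact, e.g. a segment. *)
Definition dist_to x D : R := inf [set edist2 x y | y in D].

(* Delta_delta: T is the triangle and S the side. *)
Definition far_part (T S : set (R * R)) (delta : R) : set (R * R) :=
  [set x | T x /\ delta < dist_to x S].

(* v agrees on D with a polynomial of degree at most p in each variable; the
   values of v off D are irrelevant.  With q.[a, b] = q.[a%:P].[b], size and
   sizeY are one plus the degrees in the first and second variable. *)
Definition Qp (p : nat) D v : Prop :=
  exists q : {poly {poly R}}, [/\ (size q <= p.+1)%N, (sizeY q <= p.+1)%N &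
    forall x, D x -> v x = q.[x.1, x.2]].

Definition lebesgue2 := (@lebesgue_measure R \x @lebesgue_measure R)%E.

(* v \_ D is v on D and 0 off D. *)
Definition L2norm D v : \bar R := 'N[lebesgue2]_2%:E[EFin \o (v \_ D)]%E.

Definition TT (t : R) : R := t + Num.sqrt (t ^+ 2 - 1).

End Plane.

(* Main.v *)
Require Import Defs.
From HB Require Import structures.
From mathcomp Require Import all_boot all_order all_algebra.
From mathcomp Require Import zify ring lra.
From mathcomp Require Import all_classical all_reals all_analysis.
From mathcomp Require Import measurable_realfun.
Import Order.TTheory GRing.Theory Num.Theory.
Import numFieldNormedType.Exports.
Local Open Scope classical_set_scope.
Local Open Scope ring_scope.

(** The distance from a point of the triangle to BC is at least its height, so
    Delta_delta contains the part of Delta of height > delta.  The integral of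
    v^2 over the horizontal slice at height h is a polynomial G(h) of degree at
    most 4p+1, so by Tonelli the integral of v^2 over the part of Delta above
    height h is a polynomial F(h) of degree at most 4p+2, nonnegative and
    decreasing on [0, a2].  Hence |F| <= F(delta) on [delta, a2], and
    Chebyshev's bound on the growth of a polynomial outside an interval
    estimates F(0) by F(delta): the affine map sending [delta, a2] to [-1, 1]
    and delta to 1 sends 0 to (a2 + delta) / (a2 - delta).
    The exponent in the theorem, doubled by squaring the norms, is 4p+3. *)

(** * Chebyshev polynomials and the growth of polynomials outside an interval *)

Fixpoint cheb (R : nzRingType) (n : nat) : {poly R} :=
  match n with
  | 0 => 1
  | 1 => 'X
  | (m.+1 as k).+1 => 'X *+ 2 * cheb R k - cheb R m
  end.

Lemma chebSS (R : nzRingType) n :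
  cheb R n.+2 = 'X *+ 2 * cheb R n.+1 - cheb R n.
Proof. by []. Qed.

Lemma nat_ind2 (P : nat -> Prop) :
  P 0%N -> P 1%N -> (forall n, P n -> P n.+1 -> P n.+2) -> forall n, P n.
Proof.
move=> P0 P1 PSS n; suff [] : P n /\ P n.+1 by [].
by elim: n => // n [Pn PSn]; split=> //; exact: PSS.
Qed.

Lemma size_cheb (R : nzRingType) n : (size (cheb R n) <= n.+1)%N.
Proof.
elim/nat_ind2: n => [||n IH0 IH1]; rewrite ?size_poly1 ?size_polyX//.
rewrite chebSS (leq_trans (size_polyD _ _))// geq_max size_polyN.
apply/andP; split; last by rewrite (leq_trans IH0)// ltnW.
rewrite mulrnAl mulr2n (leq_trans (size_polyD _ _))// maxnn.
by rewrite (leq_trans (size_polyMleq _ _))// size_polyX.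
Qed.

Lemma cheb_cos (R : realType) n (t : R) : (cheb R n).[cos t] = cos (t *+ n).
Proof.
elim/nat_ind2: n => [||n IH0 IH1]; first by rewrite hornerC mulr0n cos0.
  by rewrite hornerX.
rewrite chebSS !hornerE IH0 IH1.
have -> : t *+ n.+2 = t *+ n.+1 + t by rewrite mulrSr.
have -> : t *+ n = t *+ n.+1 - t by rewrite mulrSr addrK.
by rewrite cosB cosD; ring.
Qed.

(** With r = sqrt(x^2 - 1), both x + r and x - r are roots of y^2 = 2xy - 1, so their powers obey
    the Chebyshev recurrence and T_n(x) is the mean of their n-th powers. The larger of the two is
    (x + r)^n. *)
Lemma cheb_le_TT (R : realType) n (x : R) :
  1 <= x -> (cheb R n).[x] <= TT x ^+ n.
Proof.
move=> x1; rewrite /TT; set r := Num.sqrt _.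
have r2 : r ^+ 2 = x ^+ 2 - 1 by rewrite sqr_sqrtr// subr_ge0 exprn_ege1.
have r0 : 0 <= r by exact: sqrtr_ge0.
have chebE : (cheb R n).[x] *+ 2 = (x + r) ^+ n + (x - r) ^+ n.
  elim/nat_ind2: n => [||n IH0 IH1]; first by rewrite hornerC !expr0 mulr2n.
    by rewrite hornerX; ring.
  have sqrE y : y ^+ 2 = y * x *+ 2 - 1 -> y ^+ n.+2 = x *+ 2 * y ^+ n.+1 - y ^+ n.
    by move=> y2; rewrite -addn2 exprD y2 exprS; ring.
  rewrite !sqrE; [|by rewrite ?sqrrB ?sqrrD r2; ring..].
  rewrite chebSS hornerD hornerN hornerM hornerMn hornerX.
  set c0 := (cheb R n).[x]; set c1 := _.[x].
  have -> : (x *+ 2 * c1 - c0) *+ 2 = x *+ 2 * (c1 *+ 2) - c0 *+ 2 by ring.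
  by rewrite IH0 IH1; ring.
have xr : 0 <= x - r.
  by rewrite subr_ge0 -(@ler_pXn2r _ 2)// ?nnegrE ?r2; lra.
have : (x - r) ^+ n <= (x + r) ^+ n by rewrite lerXn2r ?nnegrE; lra.
rewrite -subr_ge0 => ?; lra.
Qed.

(** This gives the sign of a Lagrange denominator with decreasing nodes: exactly k indices lie below
    k. *)
Lemma prod_sign_lt (R : comPzRingType) n (k : 'I_n) :
  \prod_(j < n | j != k) (if (j < k)%N then -1 else 1) = (-1) ^+ k :> R.
Proof.
rewrite -big_mkcondr/= (eq_bigl (fun j : 'I_n => (j < k)%N)); last first.
  by move=> j /=; rewrite -val_eqE/=; case: ltngtP.
by rewrite (big_ord_narrow (ltnW (ltn_ord k))) prodr_const card_ord.
Qed.

(* Lagrange interpolation at the extremal points x_k = cos (k pi / n): the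
   basis polynomials have the sign (-1)^k = T_n(x_k) to the right of 1, so the
   coefficients of P are dominated by those of M T_n. *)
Lemma horner_le_cheb (R : realType) n (P : {poly R}) (M x : R) :
  (0 < n)%N -> (size P <= n.+1)%N ->
  (forall y, -1 <= y <= 1 -> `|P.[y]| <= M) -> 1 <= x ->
  `|P.[x]| <= M * (cheb R n).[x].
Proof.
move=> n0 sP PM x1.
pose th (k : nat) : R := pi / n%:R *+ k.
have nR : 0 < n%:R :> R by rewrite ltr0n.
have dpi : 0 < pi / n%:R :> R by rewrite divr_gt0 ?pi_gt0.
have th_itv k : (k <= n)%N -> th k \in `[0, pi].
  move=> kn; rewrite in_itv/= mulrn_wge0 ?(ltW dpi)//= /th.
  by rewrite -mulr_natr mulrAC ler_pdivrMr// ler_pM2l ?pi_gt0// ler_nat.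
(* extended arbitrarily but injectively, since lagrange takes nodes in nat -> R *)
pose u k : R := if (k <= n)%N then cos (th k) else k%:R.
have uE (k : 'I_n.+1) : u k = cos (th k) by rewrite /u -ltnS ltn_ord.
have u_gt k : (n < k)%N -> 1 < u k.
  by move=> nk; rewrite /u leqNgt nk/= ltr1n (leq_ltn_trans n0).
have u_le k : (k <= n)%N -> u k <= 1 by move=> kn; rewrite /u kn cos_le1.
have u_lt j k : (j < k)%N -> (k <= n)%N -> u k < u j.
  move=> jk kn; have jn := leq_trans (ltnW jk) kn.
  by rewrite /u kn jn ltr_cos ?th_itv// /th ltr_pMn2l.
have u_inj : injective u.
  move=> j k; wlog jk : j k / (j <= k)%N.
    by move=> W ujk; case/orP: (leq_total j k) => /W ->.
  move=> ujk; apply/eqP; rewrite eqn_leq jk leqNgt; apply/negP => jk'.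
  have [kn|nk] := leqP k n; first by have := u_lt _ _ jk' kn; rewrite ujk ltxx.
  have [jn|nj] := leqP j n.
    by have := u_le _ jn; rewrite ujk leNgt u_gt.
  move: ujk; rewrite /u leqNgt nj/= leqNgt nk/= => /eqP.
  by rewrite eqr_nat => /eqP e; rewrite e ltnn in jk'.
have chebu (k : 'I_n.+1) : (cheb R n).[u k] = (-1) ^+ k.
  rewrite uE cheb_cos -mulrnA mulnC mulrnA -(mulr_natr (pi / _)).
  rewrite divfK ?gt_eqF//.
  by rewrite -[pi *+ k]add0r (alternatingn (@cosDpi R)) cos0 mulr1.
set L := tnth (n.+1.-lagrange u).
(* The sign, its own inverse, joins the denominator and makes each factor [u k - u j] nonnegative;
   the numerator factors [x - u j] are nonnegative since [u j <= 1 <= x]. *)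
have Lge0 (k : 'I_n.+1) : 0 <= (-1) ^+ k * (L k).[x].
  rewrite /L lagrangeE//= hornerM hornerC !horner_prod -invr_sign.
  rewrite mulrA -invfM -(prod_sign_lt R _ k) -big_split/= mulr_ge0//.
    rewrite invr_ge0 prodr_ge0// => j jk; rewrite hornerXsubC.
    case: ltnP => [jk'|kj]; first by rewrite mulN1r opprB subr_ge0 ltW ?u_lt// -ltnS.
    rewrite mul1r subr_ge0; move: kj; rewrite leq_eqVlt => /orP[/eqP->//|kj].
    by rewrite ltW ?u_lt// -ltnS.
  apply: prodr_ge0 => j _.
  by rewrite hornerXsubC subr_ge0 (le_trans (u_le _ _))// -ltnS.
rewrite (lagrange_gen _ u_inj sP)// (lagrange_gen _ u_inj (size_cheb R n))//.
rewrite !horner_sum mulr_sumr (le_trans (ler_norm_sum _ _ _))// ler_sum// => k _.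
rewrite !hornerM !hornerC chebu normrM -/L.
rewrite -[`|(L k).[x]|](normrMsign k) (ger0_norm (Lge0 k)) ler_wpM2r//.
by apply: PM; rewrite uE cos_geN1 cos_le1.
Qed.

Lemma horner_le_TT (R : realType) n (P : {poly R}) (M a b x : R) :
  (0 < n)%N -> (size P <= n.+1)%N -> x <= a -> a < b ->
  (forall y, a <= y <= b -> `|P.[y]| <= M) ->
  `|P.[x]| <= M * TT ((a + b - 2 * x) / (b - a)) ^+ n.
Proof.
move=> n0 sP xa ab PM.
have M0 : 0 <= M by apply: (le_trans (normr_ge0 P.[a])); rewrite PM ?lexx ?(ltW ab).
have ba : 0 < b - a by rewrite subr_gt0.
set t := (X in TT X).
have t1 : 1 <= t by rewrite ler_pdivlMr//; lra.
(* The decreasing affine map of [-1, 1] onto [a, b]: it sends 1 to a, so points left of a come from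
   parameters t >= 1. *)
pose s : {poly R} := ((a + b) / 2)%:P - ((b - a) / 2) *: 'X.
have sE y : s.[y] = (a + b) / 2 - (b - a) / 2 * y by rewrite !hornerE.
have -> : P.[x] = (P \Po s).[t].
  by rewrite horner_comp sE /t; congr P.[_]; field; rewrite gt_eqF.
apply: (le_trans _ (ler_wpM2l M0 (cheb_le_TT R n _ t1))).
apply: horner_le_cheb => //.
  rewrite (leq_trans (size_comp_poly_leq _ _))// ltnS.
  have sz : (size s <= 2)%N.
    rewrite (leq_trans (size_polyD _ _))// geq_max size_polyC size_polyN.
    apply/andP; split; first by case: eqP.
    by rewrite (leq_trans (size_scale_leq _ _))// size_polyX.
  by rewrite -[n]muln1 leq_mul// -subn1 leq_subLR.
move=> y /andP[y1 y2]; rewrite horner_comp sE PM//.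
apply/andP; split.
  rewrite -subr_ge0 [leRHS](_ : _ = (b - a) / 2 * (1 - y)); last by field.
  by rewrite mulr_ge0//; lra.
rewrite -subr_ge0 [leRHS](_ : _ = (b - a) / 2 * (1 + y)); last by field.
by rewrite mulr_ge0//; lra.
Qed.

(** * Formal antiderivatives and bivariate polynomials *)

Section Antiderivative.
Context {R : idomainType}.
Implicit Types p : {poly R}.

(* The coefficient p`_0 / 0 in degree 0 is irrelevant. *)
Definition antideriv p : {poly R} :=
  \poly_(i < (size p).+1) (p`_i.-1 / i%:R).

Lemma size_antideriv p : (size (antideriv p) <= (size p).+1)%N.
Proof. exact: size_poly. Qed.

Lemma coef_antideriv p i : (antideriv p)`_i.+1 = p`_i / i.+1%:R.
Proof.
rewrite coef_poly ltnS; case: ltnP => // pi.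
by rewrite nth_default ?mul0r.
Qed.

(** Invertibility of the positive integers holds both in a field [R] of characteristic 0 and in
    [{poly R}]. Over [{poly R}] the antiderivative is taken in the outer, that is first,
    variable. *)
Lemma deriv_antideriv p :
  (forall i, (i.+1%:R : R) \is a GRing.unit) -> (antideriv p)^`() = p.
Proof.
move=> unitR; apply/polyP => i.
by rewrite coef_deriv coef_antideriv -(mulr_natr (_ / _)) divrK.
Qed.

End Antiderivative.

(** Evaluation at y is a ring morphism, so the second variable can be specialised first, leaving a
    univariate polynomial in the first one. *)
Lemma bihornerE (R : comNzRingType) (q : {poly {poly R}}) (f : {poly R}) y :
  q.[f].[y] = (map_poly (horner_eval y) q).[f.[y]].
Proof. by rewrite -[RHS]/(_.[horner_eval y f]) horner_map. Qed.

Lemma deriv_antideriv_bivariate (R : numFieldType) (q : {poly {poly R}}) :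
  (antideriv q)^`() = q.
Proof.
apply: deriv_antideriv => i.
by rewrite -polyC_natr poly_unitE size_polyC coefC/= unitfE pnatr_eq0.
Qed.

Lemma measurable_bihorner (R : realType) (q : {poly {poly R}}) (D : set (R * R)) :
  measurable_fun D (fun z : R * R => q.[z.1, z.2]).
Proof.
apply: measurable_funTS.
rewrite [X in measurable_fun _ X](_ : _ =
    (fun z => \sum_(i < size q) (q`_i).[z.2] * z.1 ^+ i)); last first.
  apply/funext => z; rewrite bihornerE hornerC (horner_coef_wide _ (size_poly _ _)).
  by apply: eq_bigr => i _; rewrite coef_map.
apply: measurable_sum => i; apply: measurable_funM.
  apply: measurableT_comp => //.
  by apply: continuous_measurable_fun; exact: continuous_horner.
exact: measurable_funX.
Qed.

Lemma integral_deriv_horner (R : realType) (P : {poly R}) (a b : R) : a <= b ->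
  (\int[@lebesgue_measure R]_(x in `[a, b]) (P^`().[x])%:E =
   (P.[b] - P.[a])%:E)%E.
Proof.
rewrite le_eqVlt => /predU1P[->|ab].
  by rewrite set_itv1 integral_set1 subrr.
rewrite (@continuous_FTC2 _ _ (horner P)) ?EFinB//.
- by apply: continuous_subspaceT => x; exact: continuous_horner.
- split=> [x _||]; first exact: derivable_horner.
  + by apply: cvg_at_right_filter; exact: continuous_horner.
  + by apply: cvg_at_left_filter; exact: continuous_horner.
- by move=> x _; rewrite -derivE.
Qed.

(** * Integration over plane regions between two polynomial graphs *)

Definition between {R : realType} (l r : {poly R}) (I : set R) : set (R * R) :=
  [set z | I z.2 /\ l.[z.2] <= z.1 <= r.[z.2]].

Lemma measurable_between (R : realType) (l r : {poly R}) (I : set R) :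
  measurable I -> measurable (between l r I).
Proof.
move=> mI.
have mp (p : {poly R}) : measurable_fun setT (fun z : R * R => p.[z.2]).
  apply: measurableT_comp => //.
  by apply: continuous_measurable_fun; exact: continuous_horner.
rewrite [X in measurable X](_ : _ = (snd @^-1` I) `&`
  ((setT `&` [set z | l.[z.2] <= z.1]) `&` (setT `&` [set z | z.1 <= r.[z.2]]))).
  apply: measurableI; first by
    rewrite -[X in measurable X]setTI; exact: measurable_snd.
  by apply: measurableI; apply: measurable_fun_le.
apply/seteqP; split=> z /=; first by case=> ? /andP[? ?]; do ?split.
by case=> ? [[_ ?] [_ ?]]; split=> //; apply/andP.
Qed.

(** The integral of q over the horizontal slice from l to r. Since the endpoints are polynomials in
    the height, so is the result. *)
Definition fibre_integral {R : realType} (q : {poly {poly R}}) (l r : {poly R}) :=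
  (antideriv q).[r] - (antideriv q).[l].

(** Tonelli, with the height as outer variable; the inner integral is computed by the fundamental
    theorem of calculus. *)
Lemma integral_between (R : realType) (q : {poly {poly R}}) (l r : {poly R})
    (I : set R) :
  measurable I -> (forall h, I h -> l.[h] <= r.[h]) ->
  (forall x h, 0 <= q.[x, h]) ->
  (\int[@lebesgue2 R]_z (((fun z : R * R => q.[z.1, z.2]) \_ (between l r I)) z)%:E
   = \int[@lebesgue_measure R]_(h in I) ((fibre_integral q l r).[h])%:E)%E.
Proof.
move=> mI lr q0; rewrite fubini_tonelli2; last 2 first.
- apply/measurable_EFinP/(measurable_restrictT _ (measurable_between R l r I mI)).
  exact: measurable_bihorner.
- by move=> z; rewrite lee_fin patchE; case: ifP.
rewrite [RHS]integral_mkcond; apply: eq_integral => h _.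
rewrite /fubini_G [RHS]patchE; case: ifPn => [|/negP] hI.
  have Ih : I h by rewrite inE in hI.
  rewrite /fibre_integral hornerD hornerN !bihornerE.
  set U := map_poly (horner_eval h) (antideriv q).
  rewrite -(integral_deriv_horner R U _ _ (lr h Ih)) [RHS]integral_mkcond.
  apply: eq_integral => x _; rewrite !patchE.
  rewrite [x \in _](_ : _ = ((x, h) \in between l r I)); last first.
    apply/idP/idP; rewrite !inE/= in_itv/=; first by split.
    by case.
  case: ifP => // _; rewrite /U deriv_map deriv_antideriv_bivariate.
  by rewrite bihornerE hornerC.
(* At a height outside I the slice is empty. *)
apply: integral0_eq => x _; rewrite patchE ifF//.
by apply/negP => /set_mem[/= Ih _]; apply: hI; rewrite inE.
Qed.

(** Each term is a coefficient of degree below k times a power of f with exponent at most m, where f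
    has degree at most 1. *)
Lemma size_antideriv_horner (R : idomainType) (q : {poly {poly R}})
    (f : {poly R}) m k :
  (size q <= m)%N -> (sizeY q <= k)%N -> (size f <= 2)%N ->
  (size (antideriv q).[f]%R <= k + m)%N.
Proof.
move=> qm qk f2; rewrite (horner_coef_wide _ (size_antideriv q)).
apply: (leq_trans (size_sum _ _ _)); apply/bigmax_leqP => -[[|i] /= iq] _.
  (* The term of index 0 vanishes by the convention that the inverse of 0 is 0. *)
  by rewrite coef_poly/= invr0 mulr0 mul0r size_poly0.
have im : (i < m)%N by apply: leq_trans qm.
rewrite coef_antideriv -polyC_natr polyCV [q`_i * _]mulrC mul_polyC -scalerAl.
apply: (leq_trans (size_scale_leq _ _)); apply: (leq_trans (size_polyMleq _ _)).
have qi := leq_trans (max_size_coefXY q i) qk.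
have fi : (size (f ^+ i.+1)%R <= i.+2)%N.
  apply: (leq_trans (size_poly_exp_leq _ _)); rewrite ltnS -[leqRHS]mul1n.
  by rewrite leq_mul// -subn1 leq_subLR.
rewrite -subn1 leq_subLR (leq_trans (leq_add qi fi))//.
by rewrite addnCA leq_add2l.
Qed.

Lemma size_fibre_integral (R : realType) (q : {poly {poly R}}) (l r : {poly R}) m k :
  (size q <= m)%N -> (sizeY q <= k)%N -> (size l <= 2)%N -> (size r <= 2)%N ->
  (size (fibre_integral q l r) <= k + m)%N.
Proof.
move=> qm qk l2 r2; rewrite /fibre_integral (leq_trans (size_polyD _ _))//.
by rewrite geq_max size_polyN !size_antideriv_horner.
Qed.

Lemma sizeY_mulleq (R : comNzRingType) (q s : {poly {poly R}}) :
  (sizeY (q * s)%R <= (sizeY q + sizeY s).-1)%N.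
Proof. by rewrite !sizeYE rmorphM size_polyMleq. Qed.

(** The integral of a nonnegative function is the supremum over the simple functions below it, and
    these only increase in number from f to g, measurable or not. This serves for the set
    [Delta_delta], defined through an infimum of distances. *)
Lemma le_integral_ge0 d (T : measurableType d) (R : realType)
    (mu : {measure set T -> \bar R}) (f g : T -> \bar R) :
  (forall x, 0 <= f x)%E -> (forall x, f x <= g x)%E ->
  (\int[mu]_x f x <= \int[mu]_x g x)%E.
Proof.
move=> f0 fg.
rewrite !ge0_integralTE//; last by move=> x; exact: le_trans (fg x).
by apply: le_ereal_sup => _ [h /= hf <-]; exists h => // x; exact: le_trans (fg x).
Qed.

(** * The L2 norm and the geometry of the triangle *)

Lemma L2normE (R : realType) (D : set (R * R)) (v : R * R -> R) :
  L2norm D v =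
    ((\int[@lebesgue2 R]_z (((fun x => v x ^+ 2) \_ D) z)%:E) `^ 2^-1)%E.
Proof.
rewrite /L2norm unlock; congr poweR; apply: eq_integral => z _ /=.
rewrite !patchE; case: ifP => _; rewrite /= powR_mulrn// ?real_normK ?num_real//.
(* Off D both restrictions take the default value [point], which is 0 in [R] and is fixed by
   squaring. *)
by rewrite (_ : point = 0 :> R)// expr0n.
Qed.

(** Points of the base have height 0, so dropping the horizontal term of the Euclidean distance
    leaves |x.2|. The vertex B shows that the set of distances is nonempty, as a lower bound on
    [inf] requires. *)
Lemma le_dist_to_base (R : realType) (c1 : R) (x : R * R) :
  x.2 <= dist_to x (segment (0, 0) (c1, 0)).
Proof.
apply: lb_le_inf.
  exists (edist2 x (0, 0)), (0, 0) => //.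
  by exists 1, 0; split=> //=; rewrite ?ler01 ?mulr0 ?addr0// mul0r addr0.
move=> _ [y [s [t [_ _ _ _ /=]]] y2 <-].
rewrite !mulr0 addr0 in y2; rewrite /edist2 y2 subr0.
apply: (le_trans (ler_norm _)); rewrite -sqrtr_sqr ler_wsqrtr//.
by rewrite lerDr sqr_ge0.
Qed.

Section Triangle.
Context {R : realType} (a1 a2 c1 : R) (a2_gt0 : 0 < a2) (c1_gt0 : 0 < c1).
(** The sides AB and CA as functions of the height h: the slice has width c1 (1 - h / a2). *)
Let l : {poly R} := (a1 / a2) *: 'X.
Let r : {poly R} := l + (c1%:P - (c1 / a2) *: 'X).

Lemma left_side_le_right_side h : h <= a2 -> l.[h] <= r.[h].
Proof.
move=> ha; rewrite hornerD lerDl !hornerE -mulrA -mulrN1.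
rewrite -[X in X + _]mulr1 mulrN1 -mulrBr mulr_ge0 ?(ltW c1_gt0)//.
by rewrite subr_ge0 mulrC ler_pdivrMr ?mul1r.
Qed.

Lemma triangle_between :
  triangle (a1, a2) (0, 0) (c1, 0) = between l r `[0, a2].
Proof.
have a20 : a2 != 0 by rewrite gt_eqF.
have c10 : c1 != 0 by rewrite gt_eqF.
apply/seteqP; split=> -[x h]/=; rewrite /between/= in_itv/= /r /l
    !(hornerD, hornerN, hornerC, hornerZ, hornerX).
  move=> [u [s [t [[u0 s0 t0] ust /= -> ->]]]].
  have uE : u = 1 - s - t by lra.
  (* These products become the atoms of the linear arithmetic below. *)
  have := mulr_ge0 u0 (ltW a2_gt0); have := mulr_ge0 s0 (ltW a2_gt0).
  have := mulr_ge0 s0 (ltW c1_gt0); have := mulr_ge0 t0 (ltW c1_gt0).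
  have := mulr_ge0 t0 (ltW a2_gt0); rewrite {}uE => ta tc sc sa ua.
  rewrite !mulr0 !addr0.
  split; first by apply/andP; split; lra.
  rewrite (_ : a1 / a2 * ((1 - s - t) * a2) = a1 * (1 - s - t)); last by field.
  rewrite (_ : c1 / a2 * ((1 - s - t) * a2) = c1 * (1 - s - t)); last by field.
  by apply/andP; split; lra.
move=> [/andP[h0 ha] /andP[lx xr]].
(* Barycentric coordinates: only A has nonzero height, which fixes its weight; the weight of C is
   the horizontal offset from AB divided by c1. *)
exists (h / a2), (1 - h / a2 - (x - a1 / a2 * h) / c1), ((x - a1 / a2 * h) / c1).
split; [split| | |]; rewrite /=.
- by rewrite divr_ge0// ltW.
- rewrite subr_ge0 ler_pdivrMr// [leRHS](_ : _ = c1 - c1 / a2 * h); first by lra.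
  by field.
- by rewrite divr_ge0 ?(ltW c1_gt0)// subr_ge0.
- by ring.
- by rewrite mulr0 addr0 divfK//; field.
- by rewrite !mulr0 !addr0 divfK.
Qed.
End Triangle.

(** * The norm inequality on the triangle *)

Theorem lemma2p4 (R : realType) (a1 a2 c1 delta : R) (p : nat) :
  let A : R * R := (a1, a2) in
  let B : R * R := (0, 0) in
  let C : R * R := (c1, 0) in
  let Delta := triangle A B C in
  let Delta_delta := far_part Delta (segment B C) delta in
  0 < a2 -> 0 < c1 -> 0 < delta -> delta < a2 -> (1 <= p)%N ->
  forall v : R * R -> R, Qp p Delta v ->
  (L2norm Delta v <=
    (TT ((1 + delta * a2^-1) / (1 - delta * a2^-1))
       `^ (2 * p%:R + 3 / 2))%:E * L2norm Delta_delta v)%E.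
Proof.
move=> A B C Delta Delta_delta a20 c10 d0 da _ v [w [sw swY vw]].
pose l : {poly R} := (a1 / a2) *: 'X.
pose r : {poly R} := l + (c1%:P - (c1 / a2) *: 'X).
have sl2 c : (size (c *: 'X : {poly R}) <= 2)%N.
  by rewrite (leq_trans (size_scale_leq _ _))// size_polyX.
have sr : (size r <= 2)%N.
  apply: (leq_trans (size_polyD _ _)); rewrite geq_max sl2/=.
  apply: (leq_trans (size_polyD _ _)); rewrite geq_max size_polyN sl2 andbT.
  by rewrite (leq_trans (size_polyC_leq1 _)).
pose G := fibre_integral (w * w) l r.
have sG : (size G <= 4 * p + 2)%N.
  (* The square of w has degree at most 2p, hence size at most 2p+1, in each variable. *)
  have -> : (4 * p + 2 = (p.+1 + p.+1).-1 + (p.+1 + p.+1).-1)%N by lia.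
  apply: size_fibre_integral; rewrite ?sl2 ?sr//.
    by apply: (leq_trans (size_polyMleq _ _)); rewrite -!subn1 leq_sub2r// leq_add.
  by apply: (leq_trans (sizeY_mulleq _ _ _)); rewrite -!subn1 leq_sub2r// leq_add.
have w0 x h : 0 <= (w * w).[x, h] by rewrite !hornerM sqr_ge0.
pose H := antideriv G.
have H'E : H^`() = G.
  by apply: deriv_antideriv => i; rewrite unitfE pnatr_eq0.
have lr h : h <= a2 -> l.[h] <= r.[h] by exact: left_side_le_right_side.
have intG c : c <= a2 ->
    (\int[@lebesgue2 R]_z (((fun z : R * R => (w * w).[z.1, z.2]) \_
      (between l r `[c, a2])) z)%:E = (H.[a2] - H.[c])%:E)%E.
  move=> ca; rewrite integral_between//; last first.
    by move=> h /=; rewrite in_itv/= => /andP[_]; exact: lr.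
  by rewrite -/G -H'E integral_deriv_horner.
have Hmono c d : c <= d -> d <= a2 -> H.[c] <= H.[d].
  move=> cd da2; rewrite -subr_ge0 -lee_fin -integral_deriv_horner// H'E.
  rewrite -integral_between//; last first.
    by move=> h /=; rewrite in_itv/= => /andP[_ hd]; exact: lr (le_trans hd da2).
  by apply: integral_ge0 => z _; rewrite lee_fin patchE; case: ifP.
have intD : (\int[@lebesgue2 R]_z (((fun z => v z ^+ 2) \_ Delta) z)%:E =
    (H.[a2] - H.[0])%:E)%E.
  rewrite -intG ?(ltW a20)//; apply: eq_integral => z _; congr EFin.
  rewrite !patchE -triangle_between//; case: ifP => // /set_mem zD.
  by rewrite vw// !hornerM expr2.
have intDd : ((H.[a2] - H.[delta])%:E <=
    \int[@lebesgue2 R]_z (((fun z => v z ^+ 2) \_ Delta_delta) z)%:E)%E.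
  (* The endpoint delta is removed from the interval because [far_part] asks for a distance strictly
     above delta. *)
  rewrite -integral_deriv_horner ?(ltW da)// H'E -integral_itv_obnd_cbnd; last first.
    apply/measurable_EFinP; apply: measurable_funTS.
    by apply: continuous_measurable_fun; exact: continuous_horner.
  rewrite -integral_between//; last first.
    by move=> h /=; rewrite in_itv/= => /andP[_]; exact: lr.
  apply: le_integral_ge0 => z; first by rewrite lee_fin patchE; case: ifP.
  rewrite lee_fin !patchE; case: ifPn => [/set_mem zI|_]; last first.
    by case: ifP => // _; exact: sqr_ge0.
  have zD : Delta z.
    case: zI => /=; rewrite in_itv/= => /andP[dz za] zlr.
    rewrite /Delta triangle_between//; split=> //=.
    by rewrite in_itv/= za (le_trans (ltW d0))// ltW.
  rewrite ifT; first by rewrite vw// !hornerM expr2.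
  apply/mem_set; split=> //; apply: lt_le_trans (le_dist_to_base _ _ _).
  by case: zI => /=; rewrite in_itv/= => /andP[].
have key : H.[a2] - H.[0] <= (H.[a2] - H.[delta]) *
    TT ((1 + delta * a2^-1) / (1 - delta * a2^-1)) ^+ (4 * p + 3).
  pose F := H.[a2]%:P - H.
  have FE y : F.[y] = H.[a2] - H.[y] by rewrite hornerD hornerN hornerC.
  have -> : (1 + delta * a2^-1) / (1 - delta * a2^-1) =
      (delta + a2 - 2 * 0) / (a2 - delta).
    by field; rewrite subr_eq0 !gt_eqF.
  rewrite -FE (le_trans (ler_norm _))// horner_le_TT ?ltW//.
  - by rewrite addnS.
  (* F has degree at most 4p+2, within the bound 4p+3 chosen to be twice the exponent of the
     theorem. *)
  - apply: (leq_trans (size_polyD _ _)); rewrite geq_max size_polyN.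
    rewrite (leq_trans (size_polyC_leq1 _))//=.
    apply: (leq_trans (size_antideriv _)).
    by rewrite ltnS (leq_trans sG)// leq_add2l.
  - move=> y /andP[dy ya]; rewrite FE ger0_norm ?subr_ge0 ?Hmono//.
    by rewrite lerD2l lerN2 Hmono.
rewrite !L2normE intD.
set T := TT _ in key *.
have T0 : 0 <= T.
  rewrite /T /TT addr_ge0 ?sqrtr_ge0// divr_ge0 ?subr_ge0//.
    by rewrite addr_ge0// divr_ge0 ?(ltW d0) ?(ltW a20).
  by rewrite ler_pdivrMr// mul1r (ltW da).
(* The constant is written as a square root, so that [key] can be applied under a single square root
   on each side. *)
have -> : T `^ (2 * p%:R + 3 / 2) = (T ^+ (4 * p + 3)) `^ 2^-1.
  rewrite -powR_mulrn// -powRrM; congr powR.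
  by rewrite natrD natrM; field.
have int0 : (0 <= \int[@lebesgue2 R]_z
    (((fun z => v z ^+ 2) \_ Delta_delta) z)%:E)%E.
  apply: integral_ge0 => z _; rewrite lee_fin patchE.
  by case: ifP => // _; exact: sqr_ge0.
rewrite -poweR_EFin -poweRM ?lee_fin ?exprn_ge0//.
have H0 : 0 <= H.[a2] - H.[0] by rewrite subr_ge0 Hmono// ltW.
apply: gt0_ler_poweR; rewrite ?invr_ge0//.
- by rewrite in_itv/= lee_fin H0 leey.
- by rewrite in_itv/= leey andbT mule_ge0 ?lee_fin ?exprn_ge0.
apply: (@le_trans _ _ ((T ^+ (4 * p + 3))%:E * (H.[a2] - H.[delta])%:E)%E).
  by rewrite -EFinM lee_fin mulrC.
by rewrite lee_wpmul2l// lee_fin exprn_ge0.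
Qed.
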